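(* Let $I$ be a compact interval and let $\mathcal{C}(I,\mathcal{K}_c(\mathbb{R}))$ be the space of continuous maps $I\to\mathcal{K}_c(\mathbb{R})$ with the metric $d_C(f,g)=\sup_{x\in I}\mathfrak{H}(f(x),g(x))$. The set $\mathcal{D}_1=\{f\in\mathcal{C}(I,\mathcal{K}_c(\mathbb{R})):\dim_H\mathcal{G}_*(f)=1\}$ is a dense $G_\delta$ subset of $\mathcal{C}(I,\mathcal{K}_c(\mathbb{R}))$. Furthermore, for every $f\in\mathcal{C}(I,\mathcal{K}_c(\mathbb{R}))$ there exist $g,h\in\mathcal{D}_1$ with $g=h\oplus f$.
   Context: $\mathcal{K}_c(\mathbb{R})$: non-empty compact convex subsets (compact intervals) of $\mathbb{R}$; $\mathfrak{H}$: Hausdorff distance. $(h\oplus f)(x)=h(x)\oplus f(x)$ where $A\oplus B=\{a+b:(a,b)\in\Lambda(A,B)\}$, $\Lambda(A,B)=\{(a,b)\in A\times B:a\in\Lambda_A(b)\text{ or }b\in\Lambda_B(a)\}$, $\Lambda_A(b)=\{a\in A:|b-a|=\min_{a'\in A}|b-a'|\}$. $\mathcal{G}_*(f)=\{(x,f(x)):x\in I\}$ with metric $d((x,Y),(y,Z))=|x-y|+\mathfrak{H}(Y,Z)$; $\dim_H$ is Hausdorff dimension. *)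

(* Defs.v *)
From HB Require Import structures.
From mathcomp Require Import all_boot all_order all_algebra.
From mathcomp Require Import all_classical all_reals all_analysis.
From mathcomp Require Import Rstruct Rstruct_topology.

Set Implicit Arguments.
Unset Strict Implicit.
Unset Printing Implicit Defensive.
Import Order.TTheory GRing.Theory Num.Theory.
Local Open Scope classical_set_scope.
Local Open Scope ring_scope.

Notation R := Rdefinitions.R.

(* K_c(R): non-empty compact convex subsets of R, i.e. compact intervals [a,b], a <= b *)
Definition is_Kc (A : set R) : Prop := exists a b : R, a <= b /\ A = `[a, b]%classic.
Definition Kc := {A : set R | is_Kc A}.
Definition KcS (A : Kc) : set R := proj1_sig A.

Definition pdist (x : R) (B : set R) : R := inf [set `|x - y| | y in B].
Definition hausdorff (A B : set R) : R :=
  Num.max (sup [set pdist x B | x in A]) (sup [set pdist y A | y in B]).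
Definition HK (A B : Kc) : R := hausdorff (KcS A) (KcS B).

Definition LambdaSet (A : set R) (b : R) : set R :=
  [set a | A a /\ `|b - a| = inf [set `|b - a'| | a' in A]].
Definition LambdaPair (A B : set R) : set (R * R) :=
  [set p | A p.1 /\ B p.2 /\ (LambdaSet A p.2 p.1 \/ LambdaSet B p.1 p.2)].
Definition oplus (A B : set R) : set R :=
  [set p.1 + p.2 | p in LambdaPair A B].

Definition cont_on (I : set R) (f : R -> Kc) : Prop :=
  forall x, I x -> forall e : R, 0 < e -> exists2 d : R, 0 < d &
    forall y, I y -> `|x - y| < d -> HK (f x) (f y) < e.

Definition dC (I : set R) (f g : R -> Kc) : R :=
  sup [set HK (f x) (g x) | x in I].

Definition dense_in {T} (X : set T) (d : T -> T -> R) (D : set T) : Prop :=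
  forall f, X f -> forall e : R, 0 < e -> exists g, [/\ X g, D g & d f g < e].
Definition open_in {T} (X : set T) (d : T -> T -> R) (U : set T) : Prop :=
  U `<=` X /\ forall f, U f -> exists2 e : R, 0 < e &
    forall g, X g -> d f g < e -> U g.
Definition Gdelta_in {T} (X : set T) (d : T -> T -> R) (D : set T) : Prop :=
  exists U : nat -> set T, (forall n, open_in X d (U n)) /\
    X `&` D = \bigcap_n U n.

Section HDim.
Variables (T : Type) (dist : T -> T -> R).
Local Open Scope ereal_scope.

Definition diam (U : set T) : \bar R :=
  ereal_sup [set (dist u v)%:E | u in U & v in U].

Definition hcontrib (s : R) (U : set T) : \bar R :=
  if asbool (U = set0) then 0 else
  match diam U with
  | r%:E => (r `^ s)%:E
  | +oo => +oo
  | -oo => 0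
  end.

Definition delta_cover (delta : R) (E : set T) (U : nat -> set T) : Prop :=
  E `<=` \bigcup_n U n /\ forall n, diam (U n) <= delta%:E.

Definition hmeasure_delta (s delta : R) (E : set T) : \bar R :=
  ereal_inf [set \sum_(0 <= n <oo) hcontrib s (U n) | U in delta_cover delta E].

Definition hmeasure (s : R) (E : set T) : \bar R :=
  ereal_sup [set hmeasure_delta s delta E | delta in [set delta : R | (0 < delta)%R]].

Definition hdim (E : set T) : \bar R :=
  ereal_inf [set s%:E | s in [set s : R | (0 <= s)%R /\ hmeasure s E = 0]].
End HDim.

Definition gdist (p q : R * Kc) : R := `|p.1 - q.1| + HK p.2 q.2.

Definition graph (I : set R) (f : R -> Kc) : set (R * Kc) :=
  [set (x, f x) | x in I].

(* Main.v *)
(* For interval-valued maps, the Hausdorff metric is the sup distance of the two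
   endpoint functions and the metric sum adds endpoints. The graph has dimension
   at least 1 because it projects onto [I], so membership in [D1] amounts to
   having, for every [n], a cover by balls whose radii satisfy
   [sum r^(1+1/n) <= 1/n]; by compactness each of these conditions is open,
   hence the G_delta property.
   A map satisfies them all as soon as, for every [n], it is within
   [scale n L] of an [L]-Lipschitz map for some [L]. Lipschitz maps are dense,
   which gives density. For the decomposition, approximate [f] by Lipschitz maps
   [q_k] with errors decreasing very fast compared with the previous Lipschitz
   constants and put [h = sum_k (-1)^k (f - q_k)]: then [h] is extremely close to
   Lipschitz maps at even stages, and [h + f] at odd stages. *)

Require Import Defs.
From mathcomp Require Import all_boot all_order all_algebra.
From mathcomp Require Import all_classical all_reals all_analysis.
From mathcomp Require Import Rstruct Rstruct_topology.
From mathcomp Require Import lra ring.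
Set Implicit Arguments.
Unset Strict Implicit.
Unset Printing Implicit Defensive.
Import Order.TTheory GRing.Theory Num.Theory.
Import numFieldNormedType.Exports.
Local Open Scope classical_set_scope.
Local Open Scope ring_scope.

(** * Hausdorff distance and metric sum of compact intervals *)

Lemma sup_eq_max (A : set R) (m : R) : A m -> ubound A m -> sup A = m.
Proof.
move=> Am Um; apply/eqP; rewrite eq_le; apply/andP; split.
  by apply: ge_sup => //; exists m.
by apply: ub_le_sup => //; exists m.
Qed.

Lemma inf_eq_min (A : set R) (m : R) : A m -> lbound A m -> inf A = m.
Proof.
move=> Am Lm; apply/eqP; rewrite eq_le; apply/andP; split.
  by apply: ge_inf => //; exists m.
by apply: lb_le_inf => //; exists m.
Qed.

Ltac lram := repeat match goal with
  | |- context [Order.max ?x ?y] => let H := fresh in have [H|H] := leP x y; revert H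
  | |- context [Order.min ?x ?y] => let H := fresh in have [H|H] := leP x y; revert H
  | |- context [`|?x|] => let H := fresh in have [H|H] := ger0P x; revert H
  end; intros; lra.

Lemma pdist_itv (x c d : R) : c <= d ->
  pdist x `[c, d]%classic = Num.max 0 (Num.max (c - x) (x - d)).
Proof.
move=> cd; apply: inf_eq_min.
  (* The nearest point is the projection of [x] onto [[c, d]]. *)
  exists (Num.max c (Num.min x d)); first by rewrite /= in_itv /=; lram.
  by lram.
by move=> _ [y + <-]; rewrite /= in_itv /=; lram.
Qed.

(** The distance to an interval is convex in the point, so its supremum over [[a, b]] is attained at
    one of the endpoints. *)
Lemma sup_pdist_itv (a b c d : R) : a <= b -> c <= d ->
  sup [set pdist x `[c, d]%classic | x in `[a, b]%classic] =
  Num.max 0 (Num.max (c - a) (b - d)).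
Proof.
move=> ab cd; apply: sup_eq_max.
  case: (lerP (c - a) (b - d)) => H.
    exists b; first by rewrite /= in_itv /= lexx ab.
    by rewrite pdist_itv//; lram.
  exists a; first by rewrite /= in_itv /= lexx ab.
  by rewrite pdist_itv//; lram.
by move=> _ [y + <-]; rewrite pdist_itv//= in_itv /=; lram.
Qed.

Lemma hausdorff_itv (a b c d : R) : a <= b -> c <= d ->
  hausdorff `[a, b]%classic `[c, d]%classic = Num.max `|a - c| `|b - d|.
Proof.
move=> ab cd; rewrite /hausdorff !sup_pdist_itv// -(opprB a c) -(opprB b d).
by move: (a - c) (b - d) => x y; rewrite maxACA maxxx maxACA maxNr maxrN max_r// le_max normr_ge0.
Qed.

Lemma LambdaSet_itv (c d x y : R) : c <= x <= d ->
  [\/ x = y, y < x /\ x = c | x < y /\ x = d] -> LambdaSet `[c, d]%classic y x.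
Proof.
move=> xcd xy; split; first by rewrite /= in_itv.
apply/esym/inf_eq_min; first by exists x; rewrite //= in_itv.
move=> _ [z + <-]; rewrite /= in_itv /= => /andP[cz zd].
case: xy => [->|[yx E]|[yx E]]; first by rewrite subrr normr0.
- by rewrite !ltr0_norm; lra.
- by rewrite !gtr0_norm; lra.
Qed.

(** For intervals the metric sum loses nothing against the Minkowski sum: metric pairs already
    realize every sum. *)
Lemma oplus_itv (a1 a2 b1 b2 : R) : a1 <= a2 -> b1 <= b2 ->
  oplus `[a1, a2]%classic `[b1, b2]%classic = `[a1 + b1, a2 + b2]%classic.
Proof.
move=> a12 b12; apply/seteqP; split => z.
  move=> [[x y] [/= + [/= + _]] <-] /=; rewrite !in_itv /=.
  by move=> /andP[? ?] /andP[? ?]; apply/andP; split; lra.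
rewrite /= in_itv /= => /andP[z1 z2].
(* On the fibre [x + y = z] of the box, the pair minimizing [|x - y|] is a metric pair. *)
have [x [Ax Bx E]] : exists x, [/\ a1 <= x <= a2, b1 <= z - x <= b2 &
    [\/ x = z - x, (z - x < x /\ (x = a1 \/ z - x = b2)) |
        (x < z - x /\ (x = a2 \/ z - x = b1))]].
  (* The admissible [x] fill the interval from [max a1 (z - b2)] to [min a2 (z - b1)]. The minimizer
     is [z / 2] if it lies there, and otherwise the end nearest to it, where one of the two points
     is an endpoint of its own interval. *)
  case: (ltP (z / 2) (Num.max a1 (z - b2))) => zl.
    exists (Num.max a1 (z - b2)); move: zl.
    case: (leP a1 (z - b2)) => ? ?;
      split; [lra|lra|apply: Or32; split|lra|lra|apply: Or32; split]; lra.
  case: (ltP (Num.min a2 (z - b1)) (z / 2)) => zu.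
    exists (Num.min a2 (z - b1)); move: zu.
    case: (leP a2 (z - b1)) => ? ?;
      split; [lra|lra|apply: Or33; split|lra|lra|apply: Or33; split]; lra.
  move: zl zu; rewrite ge_max le_min => /andP[? ?] /andP[? ?].
  by exists (z / 2); split; [lra|lra|apply: Or31; lra].
exists (x, z - x); last by rewrite /=; lra.
split; first by rewrite /= in_itv.
split; first by rewrite /= in_itv.
case: E => [E|[lt [E|E]]|[lt [E|E]]].
- by left; apply: LambdaSet_itv => //; apply: Or31.
- by left; apply: LambdaSet_itv => //; apply: Or32.
- by right; apply: LambdaSet_itv => //; apply: Or33.
- by left; apply: LambdaSet_itv => //; apply: Or33.
- by right; apply: LambdaSet_itv => //; apply: Or32.
Qed.

(** * Endpoints of intervals and the graph metric *)

Definition lo (A : Kc) : R := inf (KcS A).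
Definition hi (A : Kc) : R := sup (KcS A).

Lemma lo_hi (A : Kc) : lo A <= hi A /\ KcS A = `[lo A, hi A]%classic.
Proof.
rewrite /lo /hi /KcS; case: A => A [a [b [ab E]]] /=.
suff [-> ->] : inf A = a /\ sup A = b by [].
rewrite E.
split; [apply: inf_eq_min|apply: sup_eq_max] => [|y|//|y] /=.
all: by rewrite in_itv /=; lra.
Qed.

Lemma lo_le_hi (A : Kc) : lo A <= hi A. Proof. by have [] := lo_hi A. Qed.

Lemma is_Kc_max (u v : R) : is_Kc `[u, Num.max u v]%classic.
Proof. by exists u, (Num.max u v); split=> //; lram. Qed.

(* Junk value [u, u] when [v < u]. *)
Definition mkKc (u v : R) : Kc := exist is_Kc _ (is_Kc_max u v).

Lemma lo_mkKc (u v : R) : lo (mkKc u v) = u.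
Proof. by apply: inf_eq_min => [|y] /=; rewrite in_itv /=; lram. Qed.

Lemma hi_mkKc (u v : R) : u <= v -> hi (mkKc u v) = v.
Proof. by move=> uv; apply: sup_eq_max => [|y] /=; rewrite in_itv /=; lram. Qed.

Lemma HKE (A B : Kc) : HK A B = Num.max `|lo A - lo B| `|hi A - hi B|.
Proof.
rewrite /HK; have [? {1}->] := lo_hi A; have [? {1}->] := lo_hi B.
exact: hausdorff_itv.
Qed.

Lemma HKC (A B : Kc) : HK A B = HK B A.
Proof. by rewrite !HKE distrC (distrC (hi A)). Qed.

Lemma HKxx (A : Kc) : HK A A = 0.
Proof. by rewrite HKE !subrr normr0 maxxx. Qed.

Lemma HK_ge0 (A B : Kc) : 0 <= HK A B.
Proof. by rewrite HKE le_max normr_ge0. Qed.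

Lemma HK_triangle (B A C : Kc) : HK A C <= HK A B + HK B C.
Proof.
rewrite !HKE ge_max; apply/andP; split.
  by apply: le_trans (ler_distD (lo B) _ _) (lerD _ _); rewrite le_max lexx.
by apply: le_trans (ler_distD (hi B) _ _) (lerD _ _); rewrite le_max lexx orbT.
Qed.

Lemma HK_le (A B : Kc) (e : R) :
  (HK A B <= e) = (`|lo A - lo B| <= e) && (`|hi A - hi B| <= e).
Proof. by rewrite HKE ge_max. Qed.

Lemma gdistC p q : gdist p q = gdist q p.
Proof. by rewrite /gdist distrC HKC. Qed.

Lemma gdistxx p : gdist p p = 0.
Proof. by rewrite /gdist subrr normr0 HKxx addr0. Qed.

Lemma gdist_triangle r p q : gdist p q <= gdist p r + gdist r q.
Proof.
rewrite /gdist addrACA; apply: lerD; last exact: HK_triangle.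
exact: ler_distD.
Qed.

(** * Compactness of segments, real powers and series *)

(** Compactness enters as a near-covering property: the local scales combine into a statement for
    all [d] near [0] from the right, and any such [d] is a uniform scale. *)
Lemma segment_uniform (a b : R) (P : R -> R -> Prop) :
  (forall d d' x, 0 < d -> d <= d' -> P d' x -> P d x) ->
  (forall x, a <= x <= b -> exists2 d, 0 < d &
     forall y, a <= y <= b -> `|x - y| < d -> P d y) ->
  exists2 d, 0 < d & forall x, a <= x <= b -> P d x.
Proof.
move=> Pmono Ploc.
have /compact_near_coveringP/near_covering_withinP cov := @segment_compact R a b.
have : \forall d \near 0^'+, `[a, b]%classic `<=` P d.
  apply: (cov _ (0^'+) P) => x; rewrite /= in_itv /= => /Ploc[d d0 dP].
  exists ([set y | `|x - y| < d], [set e : R | 0 < e <= d]) => /=.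
    split; first exact: (@nbhsx_ballx _ R^o x d d0).
    near=> e; apply/andP; split=> //.
    by near: e; exact: nbhs_right_le.
  move=> [y e] /= [xyd /andP[e0 ed]]; rewrite in_itv /= => Iy.
  by apply: (Pmono e d) => //; exact: dP.
move=> Pnear; near (0:R)^'+ => d.
exists d => // x Ix.
by apply: (near Pnear d) => //; rewrite /= in_itv.
Unshelve. all: by end_near.
Qed.

Lemma ltr_invnS (e : R) : 0 < e -> exists n : nat, n.+1%:R^-1 < e.
Proof.
move=> e0; exists (Num.trunc e^-1).
rewrite -[ltRHS]invrK ltf_pV2 ?posrE ?invr_gt0 ?ltr0n//.
exact: Num.Theory.truncnS_gt.
Qed.

(** The base [0] is included, which calls for [t] positive because [0] to the power [0] is [1]. *)
Lemma powR_antimono (x s t : R) : 0 <= x <= 1 -> 0 < t -> s <= t ->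
  x `^ t <= x `^ s.
Proof.
move=> /andP[]; rewrite le_eqVlt => /predU1P[<- _ t0 _|x0 x1 _ st].
  by rewrite powR0 ?gt_eqF// powR_ge0.
by apply: ger_powR => //; rewrite x0.
Qed.

Lemma ler_powR_base (s x y : R) : 0 <= s -> 0 <= x -> x <= y -> x `^ s <= y `^ s.
Proof.
move=> s0 x0 xy; apply: ge0_ler_powR => //; rewrite nnegrE//.
exact: le_trans xy.
Qed.

Lemma sum_half_le1 (N : nat) : \sum_(i < N) (2^-1 : R) ^+ i.+1 <= 1.
Proof.
suff -> : \sum_(i < N) (2^-1 : R) ^+ i.+1 = 1 - 2^-1 ^+ N.
  by rewrite gerBl exprn_ge0.
elim: N => [|N IH]; first by rewrite big_ord0 expr0 subrr.
by rewrite big_ord_recr /= IH exprS; lra.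
Qed.

Lemma nneseries_le_bound (u : nat -> R) (B : R) : (forall n, 0 <= u n) ->
  (forall N, \sum_(i < N) u i <= B) ->
  (\sum_(0 <= n <oo) (u n)%:E <= B%:E)%E.
Proof.
move=> u0 uB; apply: lime_le.
  by apply: is_cvg_nneseries => n _ _; rewrite lee_fin.
by apply: nearW => N; rewrite big_mkord sumEFin lee_fin.
Qed.

(** * Diameters and covers in the graph space *)

Section Diameter.
Implicit Types (U : set (R * Kc)) (s t : R).

Lemma hcontrib_ge0 s U : (0 <= hcontrib gdist s U)%E.
Proof.
rewrite /hcontrib; case: ifP => // _; case: (diam gdist U) => // r.
by rewrite lee_fin powR_ge0.
Qed.

Lemma diam_ge0 U u : U u -> (0 <= diam gdist U)%E.
Proof.
move=> Uu; apply: ereal_sup_ubound => /=.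
by exists u => //; exists u => //; rewrite gdistxx.
Qed.

Lemma diam_le1 U : (diam gdist U <= 1)%E ->
  0 <= fine (diam gdist U) <= 1 /\
  forall u v, U u -> U v -> gdist u v <= fine (diam gdist U).
Proof.
(* The empty set has diameter [-oo], which [fine] sends to [0]. *)
move=> dU; have [->|/set0P[w Uw]] := eqVneq U set0.
  rewrite (_ : diam gdist set0 = -oo%E) /=; first by rewrite lexx ler01.
  rewrite /diam (_ : [set _ | _ in _ & _ in _] = set0) ?ereal_sup0//.
  by apply/seteqP; split => // x [u []].
have d0 := diam_ge0 Uw.
have dfin : diam gdist U \is a fin_num.
  by rewrite ge0_fin_numE// (le_lt_trans dU)// ltry.
split; first by rewrite fine_ge0//= -lee_fin fineK.
move=> u v Uu Uv; rewrite -lee_fin fineK//; apply: ereal_sup_ubound.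
by exists u => //; exists v.
Qed.

(** Powers of a number at most [1] decrease as the exponent grows. This serves with [t] slightly
    above [1] to build ball covers and with [t = 1] to compare with length. *)
Lemma powR_diam_le_hcontrib s t U : 0 < t -> s <= t -> (diam gdist U <= 1)%E ->
  ((fine (diam gdist U) `^ t)%:E <= hcontrib gdist s U)%E.
Proof.
move=> t0 st dU; have [/andP[d0 d1] _] := diam_le1 dU.
rewrite /hcontrib; case: ifPn => [/asboolP U0|/asboolP /eqP/set0P[w Uw]].
  rewrite U0 (_ : diam gdist set0 = -oo%E) /= ?powR0 ?gt_eqF//.
  rewrite /diam (_ : [set _ | _ in _ & _ in _] = set0) ?ereal_sup0//.
  by apply/seteqP; split => // x [u []].
have := diam_ge0 Uw; move: dU d0 d1; case: (diam gdist U) => //= r _ r0 r1 _.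
by rewrite lee_fin powR_antimono// r0.
Qed.

Lemma diam_ball_le (c : R * Kc) (r : R) :
  (diam gdist [set p | gdist c p < r]%R <= (2 * r)%:E)%E.
Proof.
apply: ge_ereal_sup => _ [u /= cu [v /= cv <-]]; rewrite lee_fin.
by apply: le_trans (gdist_triangle c u v) _; rewrite (gdistC u); lra.
Qed.

Lemma hcontrib_ball_le (c : R * Kc) (r s : R) : 0 <= s -> 0 <= r ->
  (hcontrib gdist s [set p | gdist c p < r]%R <= ((2 * r) `^ s)%:E)%E.
Proof.
move=> s0 r0; rewrite /hcontrib; case: ifPn => [_|/asboolP /eqP/set0P[w Uw]].
  by rewrite lee_fin powR_ge0.
have := diam_ge0 Uw; have := diam_ball_le c r.
case: (diam _ _) => //= d; rewrite !lee_fin => dr d0.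
exact: ler_powR_base.
Qed.

End Diameter.

(* Degenerate balls [r i = 0] are empty, so finite families are included. *)
Definition ball_cover (E : set (R * Kc)) (t e : R) : Prop :=
  exists (c : nat -> R * Kc) (r : nat -> R), [/\ forall i, 0 <= r i,
    (forall p, E p -> exists i, gdist (c i) p < r i) &
    forall N, \sum_(i < N) r i `^ t <= e].

(** * Dimension one of a graph in terms of ball covers *)

Lemma hmeasure0_cover (E : set (R * Kc)) (s e : R) :
  hmeasure gdist s E = 0%E -> 0 < e ->
  exists U : nat -> set (R * Kc), [/\ E `<=` \bigcup_n U n,
    forall n, (diam gdist (U n) <= 1)%E &
    (\sum_(0 <= n <oo) hcontrib gdist s (U n) < e%:E)%E].
Proof.
move=> H e0.
have /ereal_inf_lt[_ [U [EU dU] <-] Ue] : (hmeasure_delta gdist s 1%R E < e%:E)%E.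
  apply: (@le_lt_trans _ _ (hmeasure gdist s E)); last by rewrite H lte_fin.
  by apply: ereal_sup_ubound; exists 1%R => //=.
by exists U.
Qed.

(** A set of diameter [d] lies in an open ball around any of its points as soon as the radius
    exceeds [d]. The radius [2 * d] works for [d > 0], at the price of a factor [2 ^ t] in the sum,
    and [rho] takes care of [d = 0]. *)
Lemma hmeasure0_ball_cover (E : set (R * Kc)) (s t e : R) :
  hmeasure gdist s E = 0%E -> 0 < t -> s <= t -> 0 < e -> ball_cover E t e.
Proof.
move=> H t0 st e0; have P2 : 0 < 2 `^ t :> R by exact: powR_gt0.
have [|U [EU dU Ue]] := @hmeasure0_cover E s (e / 2 / 2 `^ t) H.
  by rewrite !divr_gt0.
pose d i := fine (diam gdist (U i)).
(* Chosen so that the powers [rho i ^ t] form a geometric series with sum at most [e / 2]. *)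
pose rho i := (e / 2 * 2^-1 ^+ i.+1) `^ t^-1.
have d01 i : 0 <= d i <= 1 by have [] := diam_le1 (dU i).
have d0 i : 0 <= d i by have /andP[] := d01 i.
have rho0 i : 0 < rho i by rewrite powR_gt0// mulr_gt0 ?divr_gt0 ?exprn_gt0.
have [p0 _] : exists p : R * Kc, True by exists (0, mkKc 0 0).
have /choice[c cU] : forall i, exists c, U i !=set0 -> U i c.
  by move=> i; have [[c Uc]|nU] := pselect (U i !=set0); [exists c|exists p0].
exists c, (fun i => Num.max (2 * d i) (rho i)); split.
- by move=> i; rewrite le_max (ltW (rho0 i)) orbT.
- move=> p /EU[i _ Uip]; exists i.
  have [_ /(_ (c i) p) le_d] := diam_le1 (dU i).
  apply: (le_lt_trans (le_d _ Uip)); first by apply: cU; exists p.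
  rewrite -/(d i) lt_max; have := d0 i; rewrite le_eqVlt => /predU1P[<-|di].
    by rewrite rho0 orbT.
  by rewrite ltr_pMl// ltr1n.
- move=> N.
  apply: (@le_trans _ _ (\sum_(i < N) (2 `^ t * d i `^ t + e / 2 * 2^-1 ^+ i.+1))).
    apply: ler_sum => i _.
    have -> : e / 2 * 2^-1 ^+ i.+1 = rho i `^ t.
      rewrite /rho -powRrM mulVf ?gt_eqF// powRr1// ltW//.
      by rewrite mulr_gt0 ?divr_gt0 ?exprn_gt0.
    rewrite -powRM//; case: (leP (2 * d i) (rho i)) => _.
      by rewrite lerDr powR_ge0.
    by rewrite lerDl powR_ge0.
  rewrite big_split /= -!mulr_sumr.
  have : \sum_(i < N) d i `^ t <= e / 2 / 2 `^ t.
    rewrite -lee_fin -sumEFin; apply/ltW/(le_lt_trans _ Ue).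
    apply: le_trans (nneseries_lim_ge N _) => [|n _ _]; last exact: hcontrib_ge0.
    rewrite big_mkord; apply: lee_sum => i _.
    exact: powR_diam_le_hcontrib.
  rewrite ler_pdivlMr// mulrC => le1.
  have := sum_half_le1 N; rewrite -(@ler_pM2l _ (e / 2)) ?divr_gt0// => le2.
  by lra.
Qed.

(** Ball covers prescribe no mesh, but a small sum of powers forces every single radius to be
    small. *)
Lemma ball_cover_hmeasure0 (E : set (R * Kc)) :
  (forall n : nat, ball_cover E (1 + n.+1%:R^-1) n.+1%:R^-1) ->
  forall s : R, 1 < s -> hmeasure gdist s E = 0%E.
Proof.
move=> cov s s1.
suff H delta : 0 < delta -> hmeasure_delta gdist s delta E = 0%E.
  apply/eqP; rewrite eq_le; apply/andP; split.
    by apply: ge_ereal_sup => _ [delta /= d0 <-]; rewrite H.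
  by apply: ereal_sup_ubound; exists 1%R => //=; exact: H.
move=> d0; apply/eqP; rewrite eq_le; apply/andP; split; last first.
  apply: le_ereal_inf_tmp => _ [U _ <-]; apply: nneseries_ge0 => n _ _.
  exact: hcontrib_ge0.
apply/lee_addgt0Pr => e e0; rewrite add0e.
have P2 : 0 < 2 `^ s :> R by exact: powR_gt0.
(* The bound [s - 1] puts the exponent of the cover below [s]; [e / 2 ^ s] pays for passing from
   radii to diameters; [(delta / 2) ^ 2] gives [2 * r <= delta], because
   [r ^ 2 <= r ^ (1 + eps) <= eps] for [r <= 1]. *)
have [n] : exists n : nat, n.+1%:R^-1 <
    Num.min (Num.min (s - 1) (e / 2 `^ s)) ((delta / 2) ^+ 2).
  by apply: ltr_invnS; rewrite !lt_min subr_gt0 s1 divr_gt0//= exprn_gt0// divr_gt0.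
set eps : R := n.+1%:R^-1; rewrite !lt_min => /andP[/andP[ns ne] nd].
have eps01 : 0 < eps <= 1 by rewrite invr_gt0 ltr0n invf_le1 ?ltr0n ?ler1n.
have [c [r [r0 Ecov rsum]]] := cov n; rewrite -/eps in rsum.
have r_eps i : r i `^ (1 + eps) <= eps.
  have := rsum i.+1; rewrite big_ord_recr /=; apply: le_trans.
  by rewrite lerDr sumr_ge0// => j _; exact: powR_ge0.
have r1 i : r i <= 1.
  rewrite leNgt; apply/negP => ri; have := r_eps i; apply/negP; rewrite -ltNge.
  apply: (@le_lt_trans _ _ 1); first by lra.
  apply: (lt_le_trans ri); apply: le1r_powR; lra.
have r01 i : 0 <= r i <= 1 by rewrite r0 r1.
have rd i : 2 * r i <= delta.
  suff : r i <= delta / 2 by lra.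
  rewrite -(@ler_pXn2r _ 2) ?nnegrE ?divr_ge0 ?(ltW d0)//.
  apply: le_trans (ltW nd); apply: le_trans (r_eps i).
  by rewrite -powR_mulrn//; apply: powR_antimono => //; lra.
apply: ge_ereal_inf => /=.
exists (\sum_(0 <= n <oo) hcontrib gdist s [set p | gdist (c n) p < r n]%R)%E.
  exists (fun i => [set p | gdist (c i) p < r i]) => //; split.
    by move=> p /Ecov[i ?]; exists i.
  by move=> i; apply: le_trans (diam_ball_le _ _) _; rewrite lee_fin.
apply: (@le_trans _ _ (\sum_(0 <= n <oo) ((2 * r n) `^ s)%:E)%E).
  apply: lee_nneseries => i *; first exact: hcontrib_ge0.
  by apply: hcontrib_ball_le => //; lra.
apply: nneseries_le_bound => [i|N]; first exact: powR_ge0.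
apply: (@le_trans _ _ (2 `^ s * eps)); last by rewrite mulrC -ler_pdivlMr// ltW.
apply: le_trans (_ : _ <= 2 `^ s * \sum_(i < N) r i `^ (1 + eps)) _.
  rewrite mulr_sumr; apply: ler_sum => i _; rewrite powRM//.
  by rewrite ler_pM2l//; apply: powR_antimono => //; lra.
by rewrite ler_pM2l.
Qed.

(* Vertical projection is 1-Lipschitz, so a cover of the graph by sets of
   diameters [d_i] covers the base by intervals of length [2 d_i]. *)
Lemma hmeasure0_graph_ge1 (a b : R) (f : R -> Kc) (s : R) : a < b ->
  hmeasure gdist s (graph `[a, b]%classic f) = 0%E -> 1 <= s.
Proof.
move=> ab H; rewrite leNgt; apply/negP => s1.
(* Since [s < 1] and [d <= 1], the length [2 * d] is at most twice the contribution of the set, so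
   the intervals have total length at most [(b - a) / 2]. *)
have [|U [EU dU Ue]] := hmeasure0_cover (e := (b - a) / 4) H; first by lra.
pose d i := fine (diam gdist (U i)).
have /choice[c cU] : forall i, exists c, U i !=set0 -> U i c.
  move=> i; have [[c Uc]|nU] := pselect (U i !=set0); first by exists c.
  by exists (0, mkKc 0 0).
pose J i : set R := `[(c i).1 - d i, (c i).1 + d i]%classic.
have d0 i : 0 <= d i by have [/andP[]] := diam_le1 (dU i).
have IJ : `[a, b]%classic `<=` \bigcup_i J i.
  move=> x Ix; have /EU[i _ Ui] : graph `[a, b]%classic f (x, f x) by exists x.
  exists i => //; rewrite /J /= in_itv /=.
  have [_ /(_ (c i) (x, f x))] := diam_le1 (dU i).
  rewrite -/(d i) => /(_ _ Ui) => le_d.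
  have {le_d} : gdist (c i) (x, f x) <= d i by apply: le_d; apply: cU; exists (x, f x).
  rewrite /gdist /= => le_d; have := HK_ge0 (c i).2 (f x).
  have : `|(c i).1 - x| <= d i by have := HK_ge0 (c i).2 (f x); lra.
  by rewrite ler_norml; lra.
have : (lebesgue_measure (`[a, b]%classic : set R) <=
        \sum_(0 <= i <oo) lebesgue_measure (J i))%E.
  by apply: measure_sigma_subadditive => // i; exact: measurable_itv.
rewrite leNgt => /negP; apply.
rewrite lebesgue_measure_itv /= lte_fin ab -EFinD.
apply: (@le_lt_trans _ _ (2%:E * \sum_(0 <= i <oo) hcontrib gdist s (U i))%E).
  rewrite -nneseriesZl; last by move=> *; exact: hcontrib_ge0.
  apply: lee_nneseries => i *; first exact: measure_ge0.
  rewrite /J lebesgue_measure_itv /= lte_fin.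
  apply: (@le_trans _ _ (2%:E * (d i)%:E)%E).
    by case: ifP => _; rewrite -?EFinN -?EFinD -EFinM lee_fin; have := d0 i; lra.
  rewrite lee_pmul2l//.
  rewrite -(powRr1 (d0 i)); apply: powR_diam_le_hcontrib => //; exact: ltW.
apply: (@lt_trans _ _ (2%:E * ((b - a) / 4)%:E)%E).
  by rewrite lte_pmul2l.
by rewrite -EFinM lte_fin; lra.
Qed.

(** The lower bound on the dimension is automatic, and the exponents decrease to [1]; this turns
    dimension one into countably many conditions. *)
Lemma hdim_graph_eq1 (a b : R) (f : R -> Kc) : a < b ->
  hdim gdist (graph `[a, b]%classic f) = 1%:E <->
  forall n : nat,
    ball_cover (graph `[a, b]%classic f) (1 + n.+1%:R^-1) n.+1%:R^-1.
Proof.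
move=> ab; split=> [H n|cov].
  have e0 : 0 < n.+1%:R^-1 :> R by rewrite invr_gt0 ltr0n.
  have /ereal_inf_lt[_ [s [s0 Hs] <-]] :
      (hdim gdist (graph `[a, b]%classic f) < (1 + n.+1%:R^-1)%:E)%E.
    by rewrite H lte_fin ltrDl.
  rewrite lte_fin => st.
  by apply: (hmeasure0_ball_cover Hs) => //; rewrite ?ltW// addr_gt0.
apply/eqP; rewrite eq_le; apply/andP; split.
  apply/lee_addgt0Pr => e e0; rewrite -EFinD; apply: ereal_inf_lbound.
  exists (1 + e) => //; split; first by lra.
  by apply: ball_cover_hmeasure0 => //; rewrite ltrDl.
apply: le_ereal_inf_tmp => _ [s [s0 Hs] <-]; rewrite lee_fin.
exact: hmeasure0_graph_ge1 Hs.
Qed.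

(** * Continuous interval-valued maps on a segment *)

(** Indexing the endpoints by a boolean lets one argument treat both. *)
Definition bnd (A : Kc) (i : bool) : R := if i then hi A else lo A.

Lemma HK_bnd_le (A B : Kc) (e : R) :
  (HK A B <= e) <-> (forall i, `|bnd A i - bnd B i| <= e).
Proof.
rewrite HK_le; split=> [/andP[? ?] []//|H].
by rewrite (H false) (H true).
Qed.

Lemma bnd_HK_le (A B : Kc) i : `|bnd A i - bnd B i| <= HK A B.
Proof. by move: i; apply/HK_bnd_le. Qed.

Section Segment.
Variables (a b : R).
Let I : set R := `[a, b]%classic.

Lemma cont_on_uniform (f : R -> Kc) : cont_on I f -> forall e, 0 < e ->
  exists2 d, 0 < d & forall x y, I x -> I y -> `|x - y| < d -> HK (f x) (f y) < e.
Proof.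
move=> cf e e0.
have [d d0 dP] : exists2 d, 0 < d & forall x, a <= x <= b ->
    forall y, a <= y <= b -> `|x - y| < d -> HK (f x) (f y) < e.
  apply: segment_uniform => [d d' x d0 dd' H y Iy xy|x Ix].
    by apply: H => //; exact: lt_le_trans dd'.
  have {}Ix : I x by rewrite /I /= in_itv.
  have [|d d0 dP] := cf x Ix (e / 2); first by rewrite divr_gt0.
  exists (d / 2); first by rewrite divr_gt0.
  move=> y Iy xy z Iz yz.
  have H1 : HK (f x) (f y) < e / 2 by apply: dP; [rewrite /I /= in_itv|lra].
  have H2 : HK (f x) (f z) < e / 2.
    apply: dP; first by rewrite /I /= in_itv.
    by apply: le_lt_trans (ler_distD y x z) _; lra.
  by have := HK_triangle (f x) (f y) (f z); rewrite (HKC (f y) (f x)); lra.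
by exists d => // x y; rewrite /I /= !in_itv /= => Ix Iy; exact: dP.
Qed.

Lemma cont_on_bounded (f : R -> Kc) : cont_on I f ->
  exists2 M, 0 < M & forall x i, I x -> `|bnd (f x) i| <= M.
Proof.
move=> cf.
(* The bound is written [d^-1] so that it weakens as the scale [d] shrinks. *)
have [d d0 dP] : exists2 d, 0 < d & forall x, a <= x <= b ->
    forall i, `|bnd (f x) i| <= d^-1.
  apply: segment_uniform => [d d' x d0 dd' H i|x Ix].
    by apply: le_trans (H i) _; rewrite lef_pV2 ?posrE//; exact: lt_le_trans dd'.
  have {}Ix : I x by rewrite /I /= in_itv.
  have [d d0 dP] := cf x Ix 1 ltr01.
  pose M := `|lo (f x)| + `|hi (f x)| + 1.
  have M0 : 0 < M by rewrite /M; have := normr_ge0 (lo (f x)); have := normr_ge0 (hi (f x)); lra.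
  exists (Num.min d M^-1); first by rewrite lt_min d0 invr_gt0.
  move=> y Iy; rewrite lt_min => /andP[xy _] i.
  apply: (@le_trans _ _ M); last first.
    by rewrite -[leLHS]invrK lef_pV2 ?posrE ?invr_gt0// ?lt_min ?d0 ?invr_gt0// ge_min lexx orbT.
  have : HK (f x) (f y) < 1 by apply: dP => //; rewrite /I /= in_itv.
  have := bnd_HK_le (f x) (f y) i.
  have : `|bnd (f y) i| <= `|bnd (f x) i| + `|bnd (f x) i - bnd (f y) i|.
    by rewrite distrC -{1}(subrKC (bnd (f x) i) (bnd (f y) i)); exact: ler_normD.
  have : `|bnd (f x) i| <= `|lo (f x)| + `|hi (f x)|.
    by case: i; rewrite /bnd ?lerDl ?lerDr.
  by rewrite /M; lra.
exists d^-1; first by rewrite invr_gt0.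
by move=> x i; rewrite /I /= in_itv => /dP.
Qed.

(** Continuity bounds the set of distances; on an unbounded set the real [sup] would be a default
    value. *)
Lemma le_dC (f g : R -> Kc) x : cont_on I f -> cont_on I g -> I x ->
  HK (f x) (g x) <= dC I f g.
Proof.
move=> /cont_on_bounded[M M0 fM] /cont_on_bounded[M' M'0 gM'] Ix.
apply: ub_le_sup; last by exists x.
exists (M + M') => _ [y Iy <-]; apply/HK_bnd_le => i.
by apply: le_trans (ler_normB _ _) (lerD _ _); [exact: fM|exact: gM'].
Qed.

Lemma dC_le (f g : R -> Kc) (e : R) : a <= b ->
  (forall x, I x -> HK (f x) (g x) <= e) -> dC I f g <= e.
Proof.
move=> ab H; apply: ge_sup; last by move=> _ [x Ix <-]; exact: H.
by exists (HK (f a) (g a)), a => //; rewrite /I /= in_itv /= lexx.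
Qed.

(** The same balls cover the graphs of nearby maps: each graph point has positive slack in its ball,
    and compactness makes the slack uniform. *)
Lemma ball_cover_open (t e : R) (f : R -> Kc) : cont_on I f ->
  ball_cover (graph I f) t e ->
  exists2 d, 0 < d & forall g, (forall x, I x -> HK (f x) (g x) < d) ->
    ball_cover (graph I g) t e.
Proof.
move=> cf [c [r [r0 cov rsum]]].
have [d d0 dP] : exists2 d, 0 < d & forall x, a <= x <= b ->
    forall Y, HK (f x) Y < d -> exists i, gdist (c i) (x, Y) < r i.
  apply: segment_uniform => [d d' x d0 dd' H Y xY|x Ix].
    by apply: H; exact: lt_le_trans dd'.
  have {}Ix : I x by rewrite /I /= in_itv.
  have /cov[i ri] : graph I f (x, f x) by exists x.
  set s := r i - gdist (c i) (x, f x).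
  have s0 : 0 < s by rewrite /s subr_gt0.
  (* One third of the slack each for the move in the base, the oscillation of [f], and the change
     from [f y] to [Y]. *)
  have [|d d0 dP] := cf x Ix (s / 3); first by lra.
  exists (Num.min d (s / 3)); first by rewrite lt_min d0; lra.
  move=> y Iy; rewrite lt_min => /andP[xyd xys] Y; rewrite lt_min => /andP[_ fY].
  exists i.
  have := dP y _ xyd; rewrite /I /= in_itv => /(_ Iy) fxy.
  apply: le_lt_trans (gdist_triangle (x, f x) _ _) _.
  have -> : gdist (x, f x) (y, Y) = `|x - y| + HK (f x) Y by [].
  have := HK_triangle (f y) (f x) Y.
  by rewrite /s in fY xys fxy; lra.
exists d => // g gf; exists c, r; split=> // _ [x Ix <-].
by apply: dP; [move: Ix; rewrite /I /= in_itv|exact: gf].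
Qed.

(** * Approximation by Lipschitz maps and covers of graphs *)

(** With [K = L + 4 + (b - a) + n], the power [1 / n.+1] of the scale is exactly [K ^ -4], and [K]
    dominates each factor met when counting balls. *)
Definition scale (n : nat) (L : R) : R := (L + 4 + (b - a) + n%:R)^-1 ^+ (4 * n.+1).

(* One modulus [L] and one error serve both endpoints, since the covers below
   must control them on the same pieces. *)
Definition lip_approx_at (w : bool -> R -> R) (e : R -> R) : Prop :=
  exists L (p : bool -> R -> R), [/\ 0 <= L,
    forall i x y, I x -> I y -> `|p i x - p i y| <= L * `|x - y| &
    forall i x, I x -> `|w i x - p i x| <= e L].

Lemma scale_gt0 n L : a <= b -> 0 <= L -> 0 < scale n L.
Proof.
move=> ab L0; rewrite exprn_gt0// invr_gt0.
by have : 0 <= n%:R :> R by []; lra.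
Qed.

Lemma scale_le n m L : a <= b -> 0 <= L -> (n <= m)%N -> scale m L <= scale n L.
Proof.
move=> ab L0 nm; have n0 : 0 <= n%:R :> R by [].
have nmR : n%:R <= m%:R :> R by rewrite ler_nat.
rewrite /scale; set K := L + 4 + (b - a) + n%:R.
have K1 : 1 <= K by rewrite /K; lra.
apply: (@le_trans _ _ (K^-1 ^+ (4 * m.+1))).
  apply: lerXn2r; rewrite ?nnegrE ?invr_ge0; [lra|lra|].
  by rewrite lef_pV2 ?posrE /K; lra.
apply: ler_wiXn2l; rewrite ?invr_ge0 ?invf_le1//; [lra|lra|].
by rewrite leq_mul2l ltnS nm orbT.
Qed.

Lemma scale_le_invn n L : a <= b -> 0 <= L -> scale n L <= n.+1%:R^-1.
Proof.
move=> ab L0; have n0 : 0 <= n%:R :> R by [].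
rewrite /scale; set K := L + 4 + (b - a) + n%:R.
have K1 : 1 <= K by rewrite /K; lra.
apply: (@le_trans _ _ (K^-1 ^+ 1)).
  by apply: ler_wiXn2l; rewrite ?invr_ge0 ?invf_le1//; lra.
by rewrite expr1 lef_pV2 ?posrE -?natr1 /K; lra.
Qed.

Lemma sum_trunc_le (C : R) (N M : nat) : 0 <= C ->
  \sum_(i < M) (if (i < N)%N then C else 0) <= N%:R * C.
Proof.
move=> C0; apply: (@le_trans _ _ ((minn M N)%:R * C)); last first.
  by rewrite ler_wpM2r// ler_nat geq_minr.
elim: M => [|M IH]; first by rewrite big_ord0 min0n mul0r.
rewrite big_ord_recr /=; case: ltnP => MN.
  rewrite (minn_idPl MN) -natr1 mulrDl mul1r lerD2r.
  by move: IH; rewrite (minn_idPl (ltnW MN)).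
by rewrite addr0 (minn_idPr (leqW MN)); move: IH; rewrite (minn_idPr MN).
Qed.

(* At scale [eta = scale n L], the oscillation of [f] over a piece of length
   [eta] is at most [(L + 2) * eta], so about [(b - a) / eta] balls of radius
   [(L + 4) * eta] suffice; the exponent in [scale] makes [eta ^ (t - 1)]
   absorb the factors depending on [L] and [b - a]. *)
Lemma lip_approx_ball_cover n (f : R -> Kc) : a < b ->
  lip_approx_at (fun i x => bnd (f x) i) (scale n) ->
  ball_cover (graph I f) (1 + n.+1%:R^-1) n.+1%:R^-1.
Proof.
move=> ab [L [p [L0 plip fp]]].
set eta := scale n L in fp *.
have eta0 : 0 < eta by apply: scale_gt0 => //; exact: ltW.
have eta_inv : eta <= n.+1%:R^-1 by apply: scale_le_invn => //; exact: ltW.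
have n0 : 0 <= n%:R :> R by [].
have n1 : 0 < n.+1%:R :> R by [].
have inv1 : n.+1%:R^-1 <= 1 :> R by rewrite invf_le1 ?ler1n.
have eta1 : eta <= 1 by exact: le_trans eta_inv inv1.
set t := 1 + n.+1%:R^-1 : R.
have t1 : 1 < t by rewrite /t ltrDl invr_gt0.
set K := L + 4 + (b - a) + n%:R.
pose N := (Num.trunc ((b - a) / eta)).+1.
have N1 : (b - a) / eta < N%:R by exact: Num.Theory.truncnS_gt.
have N2 : N%:R <= (b - a) / eta + 1.
  rewrite -natr1 lerD2r.
  have q0 : 0 <= (b - a) / eta by apply: divr_ge0; lra.
  by have /andP[] := Num.Theory.truncn_itv q0.
pose r (i : nat) := if (i < N)%N then (L + 4) * eta else 0.
have r0 i : 0 <= r i by rewrite /r; case: ifP => // _; apply: mulr_ge0; lra.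
exists (fun i => (a + i%:R * eta, f (a + i%:R * eta))), r; split=> //.
- move=> _ [x Ix <-]; have := Ix; rewrite /I /= in_itv /= => /andP[ax xb].
  have /Num.Theory.truncn_itv : 0 <= (x - a) / eta by apply: divr_ge0; lra.
  set i := Num.trunc _; rewrite ler_pdivlMr// ltr_pdivrMr// => /andP[i1 i2].
  have iN : (i < N)%N.
    rewrite -(ltr_nat R); apply: le_lt_trans N1.
    by rewrite ler_pdivlMr//; lra.
  have Iy : I (a + i%:R * eta).
    rewrite /I /= in_itv /=; have : 0 <= i%:R * eta by rewrite mulr_ge0// ltW.
    by lra.
  exists i; rewrite /r iN /gdist /=.
  set y := a + i%:R * eta in Iy *.
  have dxy : `|y - x| <= eta.
    by rewrite ler_norml /y; move: i2; rewrite -natr1 mulrDl; lra.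
  have osc j : `|bnd (f y) j - bnd (f x) j| <= (L + 2) * eta.
    have := fp j x Ix; have := fp j y Iy; have := plip j y x Iy Ix.
    have : L * `|y - x| <= L * eta by rewrite ler_wpM2l.
    by rewrite !ler_norml; lra.
  (* The distance in the graph is at most [eta + (L + 2) * eta], strictly below the radius
     [(L + 4) * eta]. *)
  move/HK_bnd_le: osc => osc.
  by nra.
- move=> M.
  pose C := ((L + 4) * eta) `^ t.
  apply: (@le_trans _ _ (\sum_(i < M) (if (i < N)%N then C else 0))).
    apply: ler_sum => i _; rewrite /r /C; case: ifP => // _.
    by rewrite powR0// gt_eqF//; lra.
  apply: le_trans (sum_trunc_le _ _ _) _; first exact: powR_ge0.
  have K0 : 0 < K by rewrite /K; lra.
  have C1 : C <= (L + 4) * eta * ((L + 4) * K^-1 ^+ 4).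
    rewrite /C /t powRD; last by apply/implyP => _; rewrite mulf_neq0// gt_eqF//; lra.
    rewrite powRr1; last by apply: mulr_ge0; lra.
    rewrite ler_wpM2l//; first by apply: mulr_ge0; lra.
    rewrite powRM; [|lra|lra].
    apply: ler_pM; rewrite ?powR_ge0//; first by apply: ler1_powR => //; lra.
    rewrite /eta /scale -/K exprM -powR_mulrn; last by rewrite exprn_ge0// invr_ge0 ltW.
    by rewrite -powRrM mulfV ?gt_eqF// powRr1// exprn_ge0// invr_ge0 ltW.
  apply: (@le_trans _ _ (((b - a) / eta + 1) * ((L + 4) * eta * ((L + 4) * K^-1 ^+ 4)))).
    by apply: ler_pM => //; exact: powR_ge0.
  have -> : ((b - a) / eta + 1) * ((L + 4) * eta * ((L + 4) * K^-1 ^+ 4)) =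
     (b - a + eta) * (L + 4) * (L + 4) / (K * K * K) / K.
    by field; rewrite !gt_eqF.
  (* Each of [b - a + eta], [L + 4] and [L + 4] is at most [K], and [1 / K] is at most
     [1 / n.+1]. *)
  apply: (@le_trans _ _ (1 / K)); last first.
    by rewrite mul1r lef_pV2 ?posrE// -natr1 /K; lra.
  rewrite ler_wpM2r ?invr_ge0 ?(ltW K0)// ler_pdivrMr ?mulr_gt0// mul1r.
  apply: ler_pM; [|lra| |by rewrite /K; lra].
    by apply: mulr_ge0; lra.
  by apply: ler_pM; rewrite /K; lra.
Qed.

(** A uniform limit of Lipschitz maps: [scale n L] is at most [1 / n.+1] whatever [L] is. *)
Lemma lip_approx_cont (f : R -> Kc) : a <= b ->
  (forall n, lip_approx_at (fun i x => bnd (f x) i) (scale n)) -> cont_on I f.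
Proof.
move=> ab H x Ix e e0.
have [n ne] := @ltr_invnS (e / 4) ltac:(lra).
have [L [p [L0 plip fp]]] := H n.
have sc : scale n L <= e / 4.
  by apply: le_trans (ltW ne); exact: scale_le_invn.
exists (e / 4 / (L + 1)); first by rewrite divr_gt0; lra.
move=> y Iy; rewrite ltr_pdivlMr ?ltr_wpDl// => xy.
apply: (@le_lt_trans _ _ (3 * (e / 4))); last by lra.
apply/HK_bnd_le => i.
have := fp i x Ix; have := fp i y Iy; have := plip i x y Ix Iy.
have : L * `|x - y| <= e / 4 by have := normr_ge0 (x - y); nra.
by rewrite !ler_norml; lra.
Qed.

Lemma lip_approx_hdim (f : R -> Kc) : a < b ->
  (forall n, lip_approx_at (fun i x => bnd (f x) i) (scale n)) ->
  cont_on I f /\ hdim gdist (graph I f) = 1%:E.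
Proof.
move=> ab H; split; first by apply: lip_approx_cont => //; exact: ltW.
by apply/hdim_graph_eq1 => // n; exact: lip_approx_ball_cover.
Qed.

(* The approximant is the inf-convolution [x |-> inf_y (u y + L * |x - y|)]. *)
Lemma inf_convolution (u : R -> R) (M d e L : R) : 0 < d -> 0 <= L ->
  (forall x, I x -> `|u x| <= M) ->
  (forall x y, I x -> I y -> `|x - y| < d -> `|u x - u y| <= e) ->
  2 * M <= L * d ->
  exists p : R -> R,
    (forall x y, I x -> I y -> `|p x - p y| <= L * `|x - y|) /\
    (forall x, I x -> `|u x - p x| <= e).
Proof.
move=> d0 L0 uM ud LM.
pose S x := [set u y + L * `|x - y| | y in I].
have lbS x : has_lbound (S x).
  exists (- M) => _ [y Iy <-].
  have := uM y Iy; rewrite ler_norml => /andP[? _].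
  by have := mulr_ge0 L0 (normr_ge0 (x - y)); lra.
have S0 x : I x -> S x !=set0 by move=> Ix; exists (u x + L * `|x - x|), x.
exists (fun x => inf (S x)); split.
  suff H x y : I x -> I y -> inf (S x) - inf (S y) <= L * `|x - y|.
    move=> x y Ix Iy; have := H x y Ix Iy; have := H y x Iy Ix.
    by rewrite (distrC y) ler_norml; lra.
  move=> Ix Iy; rewrite lerBlDr addrC -lerBlDr.
  apply: lb_le_inf; first exact: S0.
  move=> _ [z Iz <-]; rewrite lerBlDr -addrA -mulrDr.
  apply: (@le_trans _ _ (u z + L * `|x - z|)); first by apply: ge_inf => //; exists z.
  by rewrite lerD2l ler_wpM2l// [leRHS]addrC ler_distD.
move=> x Ix.
have e0 : 0 <= e by have := ud x x Ix Ix; rewrite !subrr normr0; exact.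
have : inf (S x) <= u x.
  by apply: ge_inf => //; exists x => //; rewrite subrr normr0 mulr0 addr0.
have : u x - e <= inf (S x).
  apply: lb_le_inf; first exact: S0.
  move=> _ [y Iy <-]; case: (ltP `|x - y| d) => xy.
    have := ud x y Ix Iy xy; rewrite ler_norml.
    by have := mulr_ge0 L0 (normr_ge0 (x - y)); lra.
  (* A point at distance at least [d] cannot undercut [u x]: its penalty is at least [2 * M], a
     bound for the oscillation of [u]. *)
  have : L * d <= L * `|x - y| by rewrite ler_wpM2l.
  by have := uM x Ix; have := uM y Iy; rewrite !ler_norml; lra.
by rewrite ler_norml; lra.
Qed.

Lemma lip_approximation (f : R -> Kc) (e : R) : cont_on I f -> 0 < e ->
  lip_approx_at (fun i x => bnd (f x) i) (fun=> e).
Proof.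
move=> cf e0.
have [M M0 fM] := cont_on_bounded cf; have [d d0 fd] := cont_on_uniform cf e0.
pose L := 2 * M / d.
have L0 : 0 <= L by rewrite divr_ge0//; lra.
have LM : 2 * M <= L * d by rewrite /L divfK// gt_eqF.
have /choice[p pP] : forall i : bool, exists p : R -> R,
    (forall x y, I x -> I y -> `|p x - p y| <= L * `|x - y|) /\
    (forall x, I x -> `|bnd (f x) i - p x| <= e).
  move=> i; apply: (@inf_convolution _ M d e L) => // [x|x y Ix Iy xy]; first exact: fM.
  by apply: le_trans (bnd_HK_le _ _ _) _; apply/ltW/fd.
by exists L, p; split=> // [i|i]; have [] := pP i.
Qed.

Lemma lip_approx_add (w : bool -> R -> R) (e : R -> R) (k : bool -> R) :
  lip_approx_at w e -> lip_approx_at (fun i x => w i x + k i) e.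
Proof.
move=> [L [p [L0 plip wp]]]; exists L, (fun i x => p i x + k i); split=> // i x.
  by move=> y Ix Iy; rewrite opprD addrACA subrr addr0; exact: plip.
by move=> Ix; rewrite opprD addrACA subrr addr0; exact: wp.
Qed.

Lemma lip_approx_ext (w w' : bool -> R -> R) (e : R -> R) :
  (forall i x, I x -> w i x = w' i x) ->
  lip_approx_at w e -> lip_approx_at w' e.
Proof.
move=> ww' [L [p [L0 plip wp]]]; exists L, p; split=> // i x Ix.
by rewrite -ww'//; exact: wp.
Qed.

End Segment.

(** * Splitting by an alternating series *)

(** The intervals of centre [c m] and radius [t m] are nested; the supremum of their left ends lies
    in all of them. *)
Lemma nested_limit (c t : nat -> R) : (forall m, 0 <= t m) ->
  (forall m, `|c m.+1 - c m| <= t m - t m.+1) ->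
  exists l, forall m, `|l - c m| <= t m.
Proof.
move=> t0 ct.
have H m k : `|c (k + m)%N - c m| <= t m - t (k + m)%N.
  elim: k => [|k IH]; first by rewrite !subrr normr0.
  rewrite addSn; apply: le_trans (ler_distD (c (k + m)%N) _ _) _.
  by have := ct (k + m)%N; lra.
have nest k m : c k - t k <= c m + t m.
  have [km|mk] := leqP k m.
    by have := H k (m - k)%N; rewrite subnK// ler_norml; have := t0 m; lra.
  by have := H m (k - m)%N; rewrite subnK ?(ltnW mk)// ler_norml; have := t0 k; lra.
pose S := range (fun k => c k - t k).
exists (sup S) => m; rewrite ler_norml; apply/andP; split.
  suff : c m - t m <= sup S by lra.
  by apply: ub_le_sup; [exists (c 0%N + t 0%N) => _ [k _ <-]|exists m].
suff : sup S <= c m + t m by lra.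
by apply: ge_sup; [exists (c 0%N - t 0%N), 0%N|move=> _ [k _ <-]].
Qed.

(* The state is [(theta, Lambda)]: the error allowed for the next approximant
   and a Lipschitz bound for the alternating sum built so far. *)
Fixpoint steps (Lip : R -> R) (sc : nat -> R -> R) (k : nat) : R * R :=
  if k is k'.+1 then
    let s := steps Lip sc k' in
    let theta := Num.min (s.1 / 2) (sc k' s.2 / 2) in (theta, s.2 + Lip theta)
  else (1, 0).

(* With [q k] an approximant of [f] within [theta k], the series
   [h = sum_k (-1)^k (f - q k)] is close to the Lipschitz alternating sum of
   the [q k] at even stages, and [h + f] is at odd stages. *)
Lemma lip_approx_split (a b : R) (f : R -> Kc) : a < b ->
  cont_on `[a, b]%classic f ->
  exists h : bool -> R -> R, [/\ forall i x, `[a, b]%classic x -> `|h i x| <= 1,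
    forall n, lip_approx_at a b h (scale a b n) &
    forall n, lip_approx_at a b (fun i x => h i x + bnd (f x) i) (scale a b n)].
Proof.
move=> ab cf; set I : set R := `[a, b]%classic.
have /choice[F FP] : forall e : R, exists Lp : R * (bool -> R -> R), 0 < e ->
    [/\ 0 <= Lp.1,
    forall i x y, I x -> I y -> `|Lp.2 i x - Lp.2 i y| <= Lp.1 * `|x - y| &
    forall i x, I x -> `|bnd (f x) i - Lp.2 i x| <= e].
  move=> e; have [e0|] := ltP 0 e; last by exists (0, fun _ _ => 0).
  by have [L [p ?]] := lip_approximation cf e0; exists (L, p).
pose st := steps (fun e => (F e).1) (scale a b).
pose theta k := (st k).1; pose Lam k := (st k).2.
have st_pos k : 0 < theta k /\ 0 <= Lam k.
  elim: k => [|k [t0 L0]]; first by rewrite /theta /Lam /= ltr01.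
  have t'0 : 0 < theta k.+1.
    by rewrite /theta /= lt_min !divr_gt0//; apply: scale_gt0 => //; exact: ltW.
  split=> //; rewrite /Lam /= addr_ge0//; by have [] := FP _ t'0.
have th0 k : 0 < theta k by have [] := st_pos k.
have Lam0 k : 0 <= Lam k by have [] := st_pos k.
have th_half k : 2 * theta k.+1 <= theta k.
  have : theta k.+1 <= theta k / 2 by rewrite /theta /= ge_min lexx.
  by lra.
have th_scale k : 2 * theta k.+1 <= scale a b k (Lam k).
  have : theta k.+1 <= scale a b k (Lam k) / 2 by rewrite /theta /= ge_min lexx orbT.
  by lra.
pose q k := (F (theta k)).2.
pose T (m : nat) i x := \sum_(k < m) (-1) ^+ k * q k.+1 i x.
have T_lip m i x y : I x -> I y -> `|T m i x - T m i y| <= Lam m * `|x - y|.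
  move=> Ix Iy; elim: m => [|m IH].
    by rewrite /T !big_ord0 subrr normr0 /Lam /= mul0r.
  rewrite /T !big_ord_recr /= -/(T m i x) -/(T m i y) opprD addrACA -mulrBr.
  apply: le_trans (ler_normD _ _) _; rewrite /Lam /= -/(Lam m) mulrDl.
  apply: lerD => //; rewrite normrM normrX normrN1 expr1n mul1r.
  by have [_ + _] := FP _ (th0 m.+1); apply.
(* This is the sum over [k < m] of [(-1) ^ k * (q k.+1 - f)]: the copies of [f] cancel in pairs, and
   one remains exactly when [m] is odd. *)
pose H i x m := T m i x - (odd m)%:R * bnd (f x) i.
have H_step i x m : I x ->
    `|H i x m.+1 - H i x m| <= 2 * theta m.+1 - 2 * theta m.+2.
  (* A step costs at most [theta m.+1], and the halving of [theta] makes the bounds telescope. *)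
  move=> Ix; apply: (@le_trans _ _ (theta m.+1)); last by have := th_half m.+1; lra.
  have [_ _ /(_ i x Ix)] := FP _ (th0 m.+1); rewrite -/(q m.+1) => qf.
  rewrite /H /T big_ord_recr /= -signr_odd.
  by case: (odd m) => /=; rewrite ?expr1 ?expr0; move: qf; rewrite !ler_norml; lra.
have /choice[h' hP] : forall ix : bool * R, exists l, I ix.2 ->
    forall m, `|l - H ix.1 ix.2 m| <= 2 * theta m.+1.
  move=> [i x]; have [Ix|] := pselect (I x); last by exists 0.
  have [|m|l lP] := @nested_limit (H i x) (fun m => 2 * theta m.+1).
  - by move=> m; have := th0 m.+1; lra.
  - exact: H_step.
  - by exists l.
pose h i x := h' (i, x).
have hH i x m : I x -> `|h i x - H i x m| <= 2 * theta m.+1.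
  by move=> Ix; exact: (hP (i, x) Ix m).
exists h; split.
- move=> i x Ix; have := hH i x 0%N Ix.
  rewrite /H /T big_ord0 mul0r !subr0 => hx; apply: le_trans hx _.
  exact: th_half 0%N.
(* At even stages [H] is [T], and at odd stages it is [T - f]. In both cases the remaining error is
   twice the next [theta], which was chosen below the scale for the Lipschitz constant [Lam] of
   [T]. *)
- move=> n; exists (Lam n.*2), (T n.*2); split=> // [i x y|i x Ix]; first exact: T_lip.
  have := hH i x n.*2 Ix; rewrite /H odd_double mul0r subr0 => hx.
  apply: le_trans hx _; apply: le_trans (th_scale _) _.
  by apply: scale_le => //; [exact: ltW|rewrite -addnn leq_addr].
- move=> n; exists (Lam n.*2.+1), (T n.*2.+1); split=> // [i x y|i x Ix].
    exact: T_lip.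
  have := hH i x n.*2.+1 Ix; rewrite /H /= odd_double /= mul1r opprB addrA => hx.
  rewrite (_ : _ + _ - _ = h i x + bnd (f x) i - T n.*2.+1 i x)// in hx.
  apply: le_trans hx _; apply: le_trans (th_scale _) _.
  by apply: scale_le => //; [exact: ltW|rewrite -addnn leqW// leq_addr].
Qed.

(** * Density, the G_delta property and the decomposition *)

Lemma bnd_mkKc (u v : R) i : u <= v -> bnd (mkKc u v) i = if i then v else u.
Proof. by move=> uv; case: i; rewrite /bnd ?lo_mkKc ?hi_mkKc. Qed.

Theorem theorem4p15 (a b : R) (hab : a < b) :
  let I := `[a, b]%classic in
  let X := [set f : R -> Kc | cont_on I f] in
  let D1 := [set f : R -> Kc | X f /\ hdim gdist (graph I f) = 1%:E] in
  [/\ dense_in X (dC I) D1,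
      Gdelta_in X (dC I) D1 &
      forall f, X f -> exists g h, [/\ D1 g, D1 h &
        forall x, I x -> KcS (g x) = oplus (KcS (h x)) (KcS (f x))]].
Proof.
move=> I X D1; split.
- move=> f Xf e e0; have e4 : 0 < e / 4 by lra.
  have [L [p [L0 plip fp]]] := lip_approximation Xf e4.
  (* The approximants of the two endpoints may cross by up to [2 * (e / 4)]; raising the upper one
     by this amount restores the order and keeps the error within [3 * (e / 4)]. *)
  pose g x := mkKc (p false x) (p true x + 2 * (e / 4)).
  have pp x : I x -> p false x <= p true x + 2 * (e / 4).
    move=> Ix; have := fp false x Ix; have := fp true x Ix; have := lo_le_hi (f x).
    by rewrite /bnd !ler_norml; lra.
  have D1g : D1 g.
    apply: lip_approx_hdim => // n.
    exists L, (fun i x => p i x + (if i then 2 * (e / 4) else 0)); split=> // i x.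
      by move=> y Ix Iy; rewrite opprD addrACA subrr addr0; exact: plip.
    move=> Ix; rewrite bnd_mkKc; last exact: pp.
    rewrite (_ : (if i then _ else _) = p i x + (if i then 2 * (e / 4) else 0)).
      by rewrite subrr normr0 ltW// scale_gt0// ltW.
    by case: i; rewrite ?addr0.
  exists g; split=> //; first by case: D1g.
  apply: (@le_lt_trans _ _ (3 * (e / 4))); last by lra.
  apply: dC_le => [|x Ix]; first exact: ltW.
  apply/HK_bnd_le => i; rewrite bnd_mkKc; last exact: pp.
  by have := fp i x Ix; case: i; rewrite !ler_norml; lra.
- exists (fun n => [set f | X f /\
    ball_cover (graph I f) (1 + n.+1%:R^-1) n.+1%:R^-1]); split.
    move=> n; split=> [f []//|f [Xf cov]].
    have [d d0 dP] := ball_cover_open Xf cov; exists d => // g Xg fg.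
    split=> //; apply: dP => x Ix; apply: le_lt_trans fg.
    exact: (le_dC Xf Xg Ix).
  apply/seteqP; split=> [f [Xf [_ /(hdim_graph_eq1 _ hab) cov]] n _|f cov].
    by split=> //; exact: cov.
  have [Xf _] := cov 0%N Logic.I; split=> //; split=> //.
  by apply/hdim_graph_eq1 => // n; have [] := cov n Logic.I.
- move=> f Xf; have [h [h1 happ happf]] := lip_approx_split hab Xf.
  (* Both components of [h] lie in [[-1, 1]], so raising the upper one by [2] yields genuine
     intervals; the same shift in [gK] preserves the sum. *)
  pose k (i : bool) : R := if i then 2 else 0.
  pose hK x := mkKc (h false x + k false) (h true x + k true).
  pose gK x := mkKc (h false x + bnd (f x) false + k false)
                    (h true x + bnd (f x) true + k true).
  have hle x : I x -> h false x + k false <= h true x + k true.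
    by move=> Ix; have := h1 false x Ix; have := h1 true x Ix; rewrite !ler_norml /k; lra.
  have gle x : I x -> h false x + bnd (f x) false + k false <=
                      h true x + bnd (f x) true + k true.
    by move=> /hle; have := lo_le_hi (f x); rewrite /bnd; lra.
  exists gK, hK; split.
  + apply: lip_approx_hdim => // n.
    apply: lip_approx_ext (lip_approx_add k (happf n)) => i x Ix.
    by rewrite bnd_mkKc; [case: i|exact: gle].
  + apply: lip_approx_hdim => // n.
    apply: lip_approx_ext (lip_approx_add k (happ n)) => i x Ix.
    by rewrite bnd_mkKc; [case: i|exact: hle].
  + move=> x Ix.
    have [_ ->] := lo_hi (gK x); have [_ ->] := lo_hi (hK x).
    have [fx ->] := lo_hi (f x).
    rewrite !lo_mkKc !hi_mkKc; [|exact: hle|exact: gle].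
    rewrite oplus_itv//; last exact: hle.
    by rewrite (addrAC (h false x)) (addrAC (h true x)).
Qed.
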